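(* Let $A$ be a representation-finite finite-dimensional algebra over a field. (1) Every nonzero quotient-closed subcategory of $\mathrm{mod}\,A$ contains a splitting projective, and deleting any such indecomposable preserves quotient closure. (2) If $\mathcal C'\subsetneq\mathcal C$ is a covering relation in $\mathcal L_{\mathrm{quot}}(A)$, then $\mathrm{ind}\,\mathcal C\setminus\mathrm{ind}\,\mathcal C'$ has one element. Consequently, $\mathcal L_{\mathrm{quot}}(A)$ is graded by size. (3) Every quotient-closed subcategory is generated by its splitting projectives: every object of $\mathcal C\in\mathcal L_{\mathrm{quot}}(A)$ is a factor module of a finite direct sum of splitting projectives in $\mathcal C$. (4) For submodule-closed subcategories: (a) every nonzero submodule-closed subcategory contains a splitting injective, and deleting any such indecomposable preserves submodule closure; (b) if $\mathcal C'\subsetneq\mathcal C$ is a covering relation in $\mathcal L_{\mathrm{sub}}(A)$, then $\mathrm{ind}\,\mathcal C\setminus\mathrm{ind}\,\mathcal C'$ has one element, and hence $\mathcal L_{\mathrm{sub}}(A)$ is graded by size; (c) every submodule-closed subcategory is cogenerated by its splitting injectives: every object of $\mathcal C\in\mathcal L_{\mathrm{sub}}(A)$ is a submodule of a finite direct sum of splitting injectives in $\mathcal C$.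
   Context: Modules are finitely generated right modules. All subcategories are full, additive, and closed under isomorphisms and direct summands. $\mathrm{ind}\,A$ is a (finite) set of representatives of the isomorphism classes of indecomposable $A$-modules; $\mathrm{ind}\,\mathcal C$ is the set of members of $\mathrm{ind}\,A$ in $\mathcal C$; the size of $\mathcal C$ is $|\mathrm{ind}\,\mathcal C|$. A subcategory is identified with its set of indecomposable modules; deleting $X$ from $\mathcal C$ means passing to $\mathrm{add}(\mathrm{ind}\,\mathcal C\setminus\{X\})$. $\mathcal L_{\mathrm{quot}}(A)$ (resp. $\mathcal L_{\mathrm{sub}}(A)$) is the lattice, ordered by inclusion, of quotient-closed (resp. submodule-closed) subcategories of $\mathrm{mod}\,A$, i.e. those closed under factor modules (resp. submodules). An indecomposable $X\in\mathcal C$ is a splitting projective in $\mathcal C$ if every surjection $C\twoheadrightarrow X$ with $C\in\mathcal C$ splits; dually, it is a splitting injective in $\mathcal C$ if every injection $X\hookrightarrow C$ with $C\in\mathcal C$ splits. *)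

(* Defs.v *)
From HB Require Import structures.
From mathcomp Require Import all_boot all_algebra all_field.
From mathcomp Require Import boolp.

Set Implicit Arguments.
Unset Strict Implicit.
Unset Printing Implicit Defensive.

Import GRing.Theory.
Local Open Scope ring_scope.

Section Modules.
Variable R : nzRingType.

Definition finitely_generated (M : lmodType R) : Prop :=
  exists (n : nat) (g : 'I_n -> M),
    forall x : M, exists c : 'I_n -> R, x = \sum_i c i *: g i.

(* Objects of the category of finitely generated left R-modules; the right
   modules over an algebra A are obtained for R := A^c. *)
Record fgmod := FgMod {
  fgmod_sort :> lmodType R;
  fgmodP : finitely_generated fgmod_sort }.

Lemma finitely_generated0 : finitely_generated 'rV[R]_0.
Proof.
exists 0, (fun _ => 0) => x; exists (fun _ => 0).
by rewrite big_ord0; apply/rowP => -[].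
Qed.

Lemma finitely_generatedD (M N : fgmod) : finitely_generated (M * N)%type.
Proof.
have [m [g gP]] := fgmodP M; have [n [h hP]] := fgmodP N.
exists (m + n)%N, (fun i => match split i with
  | inl j => (g j, 0) | inr k => (0, h k) end) => -[x y].
have [c cP] := gP x; have [d dP] := hP y.
exists (fun i => match split i with inl j => c j | inr k => d k end).
rewrite big_split_ord /=.
under eq_bigr => i _ do rewrite (unsplitK (inl i)).
under [in X in _ + X]eq_bigr => i _ do rewrite (unsplitK (inr i)).
have E1 : \sum_i c i *: (g i, 0 : N) = (x, 0).
  rewrite cP; elim/big_ind2: _ => [|? ? ? ? -> ->|i _] //.
    by congr pair; rewrite addr0.
  by congr pair; rewrite scaler0.
have E2 : \sum_i d i *: (0 : M, h i) = (0, y).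
  rewrite dP; elim/big_ind2: _ => [|? ? ? ? -> ->|i _] //.
    by congr pair; rewrite addr0.
  by congr pair; rewrite scaler0.
by rewrite E1 E2; congr pair; rewrite ?addr0 ?add0r.
Qed.

Definition mod0 : fgmod := FgMod finitely_generated0.
Definition modD (M N : fgmod) : fgmod := FgMod (finitely_generatedD M N).

Definition surj (M N : fgmod) (f : M -> N) : Prop := forall y, exists x, f x = y.

Definition iso (M N : fgmod) : Prop := exists f : {linear M -> N}, bijective f.

Definition is_zero (M : fgmod) : Prop := forall x : M, x = 0.

Definition summand (M N : fgmod) : Prop := exists P : fgmod, iso N (modD M P).

Definition indecomposable (M : fgmod) : Prop :=
  ~ is_zero M /\
  forall N P : fgmod, iso M (modD N P) -> is_zero N \/ is_zero P.

Inductive finite_dsum (S : fgmod -> Prop) : fgmod -> Prop :=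
| finite_dsum0 : finite_dsum S mod0
| finite_dsumD (M N : fgmod) :
    S M -> finite_dsum S N -> finite_dsum S (modD M N).

Definition add (S : fgmod -> Prop) (M : fgmod) : Prop :=
  exists2 N : fgmod, finite_dsum S N & summand M N.

(* Full subcategories are given by their class of objects. *)
Definition subcategory (C : fgmod -> Prop) : Prop :=
  [/\ C mod0,
      forall M N, C M -> C N -> C (modD M N),
      forall M N, iso M N -> C M -> C N
    & forall M N, summand M N -> C N -> C M].

Definition Lquot (C : fgmod -> Prop) : Prop :=
  subcategory C /\
  forall (M N : fgmod) (f : {linear M -> N}), surj f -> C M -> C N.

Definition Lsub (C : fgmod -> Prop) : Prop :=
  subcategory C /\
  forall (M N : fgmod) (f : {linear M -> N}), injective f -> C N -> C M.

Definition nonzero_subcat (C : fgmod -> Prop) : Prop :=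
  exists2 M, C M & ~ is_zero M.

Definition splitting_projective (C : fgmod -> Prop) (X : fgmod) : Prop :=
  [/\ indecomposable X, C X
    & forall (M : fgmod) (f : {linear M -> X}), C M -> surj f ->
        exists s : {linear X -> M}, cancel s f].

Definition splitting_injective (C : fgmod -> Prop) (X : fgmod) : Prop :=
  [/\ indecomposable X, C X
    & forall (M : fgmod) (f : {linear X -> M}), C M -> injective f ->
        exists r : {linear M -> X}, cancel f r].

Definition subcat_lt (C' C : fgmod -> Prop) : Prop :=
  (forall M, C' M -> C M) /\ ~ (forall M, C M -> C' M).

Definition covering (L : (fgmod -> Prop) -> Prop) (C' C : fgmod -> Prop) :
    Prop :=
  [/\ L C', L C, subcat_lt C' C
    & ~ exists D, [/\ L D, subcat_lt C' D & subcat_lt D C]].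

Definition graded_by (L : (fgmod -> Prop) -> Prop)
    (rk : (fgmod -> Prop) -> nat) : Prop :=
  (forall C' C, L C' -> L C -> subcat_lt C' C -> (rk C' < rk C)%N) /\
  (forall C' C, covering L C' C -> rk C = (rk C').+1).

Section Ind.
Variables (I : finType) (ind : I -> fgmod).

(* As I is finite, the existence of such a family ind is
   representation-finiteness. *)
Definition ind_representatives : Prop :=
  [/\ forall i, indecomposable (ind i),
      forall i j, iso (ind i) (ind j) -> i = j
    & forall M, indecomposable M -> exists i, iso M (ind i)].

Definition ind_of (C : fgmod -> Prop) : {set I} := [set i | `[< C (ind i) >]].

Definition size_of (C : fgmod -> Prop) : nat := #|ind_of C|.

(* X need not be one of the chosen representatives: the one isomorphic to X is
   removed. *)
Definition delete (C : fgmod -> Prop) (X : fgmod) : fgmod -> Prop :=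
  add (fun M => exists i, [/\ i \in ind_of C, ~ iso (ind i) X & M = ind i]).

End Ind.
End Modules.

(* Main.v *)
Require Import Defs.
From HB Require Import structures.
From mathcomp Require Import all_boot all_algebra all_field.
From mathcomp Require Import boolp.

Set Implicit Arguments.
Unset Strict Implicit.
Unset Printing Implicit Defensive.

Import GRing.Theory.
Local Open Scope ring_scope.

(** Let [C] be a subcategory closed under sums and summands, and let [X] be an
    indecomposable module in [C] that is not a splitting projective.  Some
    non-split surjection [M -> X] with [M] in [C] witnesses this; splitting [M]
    into indecomposables, every element of [X] becomes a sum of values of
    non-isomorphisms [M_j -> X] with [M_j] in [C].  Those [M_j] that are not
    splitting projectives can be covered in turn, so that every element of [X]
    is the sum of an element of the trace in [X] of the splitting projectives
    of [C] and of values of composites of [n] non-isomorphisms between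
    indecomposables, for every [n] ([radical_trace]).  Over a
    representation-finite algebra the indecomposables have bounded dimension,
    so by the Harada-Sai lemma ([harada_sai]) those composites vanish for large
    [n]: the splitting projectives generate [C].  Composing with non-split
    injections out of the targets instead, the same argument shows that every
    nonzero element of a module in [C] is detected by a map to a splitting
    injective ([radical_detected]), and finitely many such maps embed the module
    ([detected_inj]).

    The Harada-Sai lemma also gives Fitting's lemma, hence the locality of the
    endomorphisms of an indecomposable [X] ([indecomposable_local]) and the
    fact that [X] cannot be a summand of [M + N] unless it is one of [M] or of
    [N] ([retract_modD]).  This identifies the deletion of [X] from [C] with
    the modules of [C] that do not have [X] as a summand ([deleteP]).  If such
    a module [M] surjects onto [N], and [X] is a splitting projective, then [X]
    is not a summand of [N], since the surjection [M -> N -> X] would split: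
    deletion preserves quotient closure.

    Finally let [C'] be covered by [C].  As [C] is generated by its splitting
    projectives, one of them, [X], is outside [C'].  Deleting it leaves a
    quotient-closed subcategory strictly inside [C] that contains [C'], hence
    is [C'] ([covering_card]). *)

(** * Retracts and direct summands *)

Section Retracts.
Variable R : nzRingType.
Implicit Types M N P X Y Z : fgmod R.

Definition linear_pack M N (f : M -> N) (lin_f : linear f) : {linear M -> N} :=
  HB.pack f (GRing.isLinear.Build R M N *:%R f lin_f).

Lemma inl_linear M N : linear (fun x : M => (x, 0) : modD M N).
Proof. by move=> a x y; congr pair; rewrite /= scaler0 addr0. Qed.

Lemma inr_linear M N : linear (fun y : N => (0, y) : modD M N).
Proof. by move=> a x y; congr pair; rewrite /= scaler0 addr0. Qed.

Lemma fst_linear M N : linear (fun z : modD M N => z.1).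
Proof. by []. Qed.

Lemma snd_linear M N : linear (fun z : modD M N => z.2).
Proof. by []. Qed.

Definition inlL M N : {linear M -> modD M N} := linear_pack (@inl_linear M N).
Definition inrL M N : {linear N -> modD M N} := linear_pack (@inr_linear M N).
Definition fstL M N : {linear modD M N -> M} := linear_pack (@fst_linear M N).
Definition sndL M N : {linear modD M N -> N} := linear_pack (@snd_linear M N).

Lemma pairD M N (z : modD M N) : z = inlL M N z.1 + inrL M N z.2.
Proof. by case: z => a b; congr pair; rewrite ?addr0 ?add0r. Qed.

Lemma copair_linear M N P (f : {linear M -> P}) (g : {linear N -> P}) :
  linear (fun z : modD M N => f z.1 + g z.2).
Proof.
move=> a x y; rewrite /= !linearP scalerDr !addrA; congr (_ + _).
by rewrite addrAC.
Qed.

Definition copair M N P f g : {linear modD M N -> P} :=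
  linear_pack (@copair_linear M N P f g).

Lemma pair_linear M N P (f : {linear P -> M}) (g : {linear P -> N}) :
  linear (fun x => (f x, g x) : modD M N).
Proof. by move=> a x y; congr pair; rewrite linearP. Qed.

Definition pairL M N P f g : {linear P -> modD M N} :=
  linear_pack (@pair_linear M N P f g).

Lemma bij_inverse M N (f : {linear M -> N}) : bijective f ->
  exists g : {linear N -> M}, cancel f g /\ cancel g f.
Proof.
by case=> g fK gK; exists (linear_pack (can2_linear fK gK)).
Qed.

Lemma linear_inj M N (f : {linear M -> N}) :
  (forall x, f x = 0 -> x = 0) -> injective f.
Proof.
move=> f0 x y fxy; apply/eqP; rewrite -subr_eq0; apply/eqP/f0.
by rewrite linearB fxy subrr.
Qed.

Lemma inj_surj_bij M N (f : {linear M -> N}) :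
  injective f -> surj f -> bijective f.
Proof.
move=> f_inj /choice[g gK]; exists g => // x.
by apply: f_inj; rewrite gK.
Qed.

Lemma iso_refl M : iso M M.
Proof. by exists idfun; exists id. Qed.

Lemma iso_sym M N : iso M N -> iso N M.
Proof. by case=> f /bij_inverse[g [fK gK]]; exists g; exists f. Qed.

Lemma iso_trans M N P : iso M N -> iso N P -> iso M P.
Proof. by case=> f bf [g bg]; exists (g \o f); apply: bij_comp. Qed.

Lemma zero_linear M N : linear (fun _ : M => 0 : N).
Proof. by move=> a x y; rewrite scaler0 addr0. Qed.

Definition zeroL M N : {linear M -> N} := linear_pack (@zero_linear M N).

Lemma mod0_is_zero : is_zero (mod0 R).
Proof. by move=> x; apply/rowP => -[]. Qed.

Lemma iso0 M : is_zero M -> iso M (mod0 R).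
Proof.
move=> M0; exists (zeroL M (mod0 R)); exists (fun _ => 0) => x.
  by rewrite (M0 x).
by rewrite (mod0_is_zero x).
Qed.

(** Retracts are the same as summands ([summand_retract], [retract_summand]),
    but avoid carrying a complement along. *)
Definition retract X M : Prop :=
  exists (s : {linear X -> M}) (r : {linear M -> X}), cancel s r.

Lemma iso_retract M N : iso M N -> retract M N.
Proof. by case=> f /bij_inverse[g [fK _]]; exists f, g. Qed.

Lemma retract_trans X Y Z : retract X Y -> retract Y Z -> retract X Z.
Proof.
case=> s [r sK] [s' [r' s'K]]; exists (s' \o s), (r \o r') => x.
by rewrite /= s'K sK.
Qed.

Lemma retractDl M N : retract M (modD M N).
Proof. by exists (inlL M N), (fstL M N). Qed.

Lemma retract_mod0 X : retract X (mod0 R) -> is_zero X.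
Proof.
by case=> s [r sK] x; rewrite -(sK x) (mod0_is_zero (s x)) linear0.
Qed.

Lemma retractDr M N : retract N (modD M N).
Proof. by exists (inrL M N), (sndL M N). Qed.

Lemma summand_retract X M : summand X M -> retract X M.
Proof.
case=> P isoM; apply: retract_trans (retractDl X P) _.
exact/iso_retract/iso_sym.
Qed.

(** Kernels of arbitrary maps may fail to be finitely generated over a general
    ring.  The kernel of an idempotent [e] is finitely generated, being the
    image of [1 - e]; this is all that splitting off summands requires. *)
Section IdempotentKernel.
Variables (M : fgmod R) (e : {linear M -> M}).
Hypothesis e_idem : forall x, e (e x) = e x.

Definition kerP : {pred M} := fun x => e x == 0.

Lemma kerP_closed : submod_closed kerP.
Proof.
split=> [|a x y]; rewrite !unfold_in ?linear0 ?eqxx // => /eqP ex /eqP ey.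
by rewrite linearP ex ey scaler0 addr0.
Qed.

HB.instance Definition _ :=
  GRing.isSubSemiModClosed.Build R M kerP
    (GRing.submod_closed_semi kerP_closed).

Record ker_type := KerElt { ker_val : M; _ : kerP ker_val }.
HB.instance Definition _ := [isSub of ker_type for ker_val].
HB.instance Definition _ := [Choice of ker_type by <:].
HB.instance Definition _ := [SubChoice_isSubLmodule of ker_type by <:].

Lemma ker_proj_subproof x : kerP (x - e x).
Proof. by rewrite /kerP linearB e_idem subrr. Qed.

Definition ker_proj_fun x : ker_type := KerElt (ker_proj_subproof x).

Lemma ker_proj_linear : linear ker_proj_fun.
Proof.
move=> a x y; apply: val_inj; rewrite /= linearP scalerBr opprD.
by rewrite addrACA.
Qed.

Lemma ker_valP (k : ker_type) : e (ker_val k) = 0.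
Proof. by case: k => x kx; exact/eqP. Qed.

Lemma ker_projK (k : ker_type) : ker_proj_fun (ker_val k) = k.
Proof. by apply: val_inj; rewrite /= ker_valP subr0. Qed.

Lemma ker_fg : finitely_generated ker_type.
Proof.
pose p : {linear M -> ker_type} := HB.pack ker_proj_fun
  (GRing.isLinear.Build R M ker_type *:%R ker_proj_fun ker_proj_linear).
have [n [g gP]] := fgmodP M; exists n, (fun i => p (g i)) => k.
have [c cP] := gP (ker_val k); exists c.
rewrite -[LHS]ker_projK -[LHS]/(p (ker_val k)) cP linear_sum.
by apply: eq_bigr => i _; rewrite linearZ.
Qed.

Definition ker_mod : fgmod R := FgMod ker_fg.

Definition ker_proj : {linear M -> ker_mod} :=
  linear_pack (N := ker_mod) ker_proj_linear.

Lemma ker_val_linear : linear (fun k : ker_mod => ker_val k : M).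
Proof. by []. Qed.

Definition ker_incl : {linear ker_mod -> M} := linear_pack ker_val_linear.

End IdempotentKernel.

(** The complement of a retract is the kernel of the idempotent [s \o r]. *)
Lemma retract_complement X M (s : {linear X -> M}) (r : {linear M -> X}) :
  cancel s r ->
  exists (P : fgmod R) (i : {linear P -> M}) (p : {linear M -> P}),
    [/\ cancel i p, forall z, r (i z) = 0, forall x, i (p x) = x - s (r x) &
        iso M (modD X P)].
Proof.
move=> sK; pose e : {linear M -> M} := s \o r.
have idem x : e (e x) = e x by rewrite /e /= sK.
pose P := ker_mod idem.
pose i : {linear P -> M} := ker_incl idem.
pose p : {linear M -> P} := ker_proj idem.
have iK : cancel i p by exact: ker_projK.
have ri z : r (i z) = 0.
  by apply: (can_inj sK); rewrite linear0; exact: ker_valP z.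
exists P, i, p; split=> //.
exists (pairL r p); exists (copair s i) => [x | [a b]] /=.
  by rewrite addrC subrK.
have ps : p (s a) = 0 by apply: val_inj; rewrite /= sK subrr.
have := linearD r (s a) (i b); have := linearD p (s a) (i b).
by rewrite sK ri ps iK addr0 add0r => pE rE; congr pair.
Qed.

Lemma retract_summand X M : retract X M -> summand X M.
Proof.
by case=> s [r /retract_complement[P [_ [_ [_ _ _ ?]]]]]; exists P.
Qed.

Lemma indecomposable_idempotent M (e : {linear M -> M}) :
  indecomposable M -> (forall x, e (e x) = e x) ->
  (forall x, e x = 0) \/ (forall x, e x = x).
Proof.
move=> [_ indM] idem.
pose i := ker_incl idem; pose p := ker_proj idem.
have iK : cancel i p by exact: ker_projK.
have [Q [j [q [_ _ jq /indM[] Z0]]]] := retract_complement iK.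
  right=> x; apply/eqP; rewrite eq_sym -subr_eq0; apply/eqP.
  by rewrite -[LHS]/(i (p x)) (Z0 (p x)) linear0.
left=> x; have : j (q x) = e x by rewrite jq /= opprB addrC subrK.
by rewrite (Z0 (q x)) linear0.
Qed.

(** The hypotheses say that [Y] is the direct sum of the image of [f] and the
    kernel of [g].  The projection onto the image along the kernel sends [y] to
    [f x] for any [x] such that [g (f x) = g y]. *)
Lemma indecomposable_middle X Y Z (f : {linear X -> Y}) (g : {linear Y -> Z}) :
  indecomposable Y -> (forall x, g (f x) = 0 -> f x = 0) ->
  (forall y, exists x, g (f x) = g y) ->
  (forall x, f x = 0) \/ (surj f /\ injective g).
Proof.
move=> indY gf0 /choice[h hP].
have gf_inj x x' : g (f x) = g (f x') -> f x = f x'.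
  move=> gfx; apply/eqP; rewrite -subr_eq0 -linearB; apply/eqP/gf0.
  by rewrite !linearB gfx subrr.
have e_lin : linear (fun y => f (h y)).
  move=> a y y'; rewrite -linearP; apply: gf_inj.
  by rewrite [f (_ + _)]linearP [RHS]linearP !hP linearP.
have [|e0|e1] := @indecomposable_idempotent Y (linear_pack e_lin) indY.
- by move=> y /=; apply: gf_inj; rewrite !hP.
- by left=> x; rewrite -(e0 (f x)) /=; apply: gf_inj; rewrite hP.
right; split=> [y|]; first by exists (h y); exact: e1.
apply: linear_inj => y gy0; rewrite -(e1 y) /=; apply: gf0.
by rewrite hP.
Qed.

Lemma retract_indecomposable X Y (s : {linear X -> Y}) (r : {linear Y -> X}) :
  ~ is_zero X -> indecomposable Y -> cancel s r -> bijective s /\ bijective r.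
Proof.
move=> X0 indY sK.
have [|y|s0|[s_surj r_inj]] := indecomposable_middle (f := s) (g := r) indY.
- by move=> x; rewrite sK => ->; rewrite linear0.
- by exists (r y); rewrite sK.
- by case: X0 => x; rewrite -(sK x) s0 linear0.
split; first by apply: inj_surj_bij => //; exact: can_inj sK.
by apply: inj_surj_bij => // x; exists (s x).
Qed.

End Retracts.

(** * Dimension over the ground field *)

Section Dimension.
Variables (F : fieldType) (A : falgType F).
Local Notation fgmod := (fgmod A^c).
Implicit Types K M N P Q X Y Z : fgmod.

(** The carrier of [M] under another name, because it gets a second module
    structure, over [F]; subspaces and ranks then come from the theory of
    finite-dimensional vector spaces. *)
Definition vect M : Type := M.
HB.instance Definition _ M := GRing.Zmodule.on (vect M).

Definition vscale M (a : F) (x : vect M) : vect M := (a%:A : A^c) *: (x : M).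

Lemma vscaleA M a b (x : vect M) : vscale a (vscale b x) = vscale (a * b) x.
Proof.
rewrite /vscale scalerA; congr (_ *: _).
by rewrite -[LHS]/((b%:A : A) * a%:A) mulr_algl scalerA mulrC.
Qed.

Lemma vscale1 M : left_id 1 (@vscale M).
Proof. by move=> x; rewrite /vscale scale1r -[1]/(1 : A^c) scale1r. Qed.

Lemma vscaleDr M : right_distributive (@vscale M) +%R.
Proof. by move=> a x y; rewrite /vscale scalerDr. Qed.

Lemma vscaleDl M x : {morph (@vscale M)^~ x : a b / a + b}.
Proof. by move=> a b; rewrite /vscale scalerDl; exact: scalerDl. Qed.

HB.instance Definition _ M := GRing.Zmodule_isLmodule.Build F (vect M)
  (@vscaleA M) (@vscale1 M) (@vscaleDr M) (@vscaleDl M).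

Definition spanned M n (g : 'I_n -> vect M) : Prop :=
  forall x : vect M, exists c : 'I_n -> F, x = \sum_i c i *: g i.

(** Products of a basis of [A] with generators of [M] span [M] over [F]. *)
Lemma spanned_exists M : exists n, `[< exists g : 'I_n -> vect M, spanned g >].
Proof.
have [n [g gP]] := fgmodP M.
pose d := \dim {:A}; pose e := vbasis {:A}.
pose T : finType := ('I_n * 'I_d)%type.
pose h (t : T) : vect M := (e`_t.2 : A^c) *: g t.1.
exists #|T|; apply/asboolP; exists (h \o enum_val) => x.
have [c cP] := gP x.
pose k (t : T) : F := coord e t.2 (c t.1).
exists (k \o enum_val).
have spanA (a : A) (y : M) :
    (a : A^c) *: y = \sum_(j < d) coord e j a *: ((e`_j : A^c) *: y : vect M).
  rewrite {1}(coord_vbasis (memvf a)) -[LHS]/(_ *: _) scaler_suml.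
  apply: eq_bigr => j _; rewrite -[RHS]/(vscale _ _) /vscale scalerA.
  by congr (_ *: _); rewrite -[RHS]/((e`_j : A) * _%:A) mulr_algr.
have /= -> : \sum_(i < #|T|) k (enum_val i) *: h (enum_val i) =
    \sum_(t : T) k t *: h t.
  rewrite (reindex (@enum_val T predT)) //.
  by exists enum_rank => t _; rewrite ?enum_valK ?enum_rankK.
rewrite cP -(pair_bigA _ (fun i j => k (i, j) *: h (i, j))) /=.
by apply: eq_bigr => i _; rewrite spanA.
Qed.

Lemma free_of_minimal M n (g : 'I_n -> vect M) : spanned g ->
  (forall m (h : 'I_m -> vect M), spanned h -> (n <= m)%N) ->
  forall c : 'I_n -> F, \sum_i c i *: g i = 0 -> forall i, c i = 0.
Proof.
case: n g => [|n] g gP n_min c c0 i; first by case: i.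
have [// | ci0] := eqVneq (c i) 0.
suff /n_min : spanned (fun j => g (lift i j)) by rewrite ltnn.
move=> x.
have gi : g i = \sum_j (- (c i)^-1 * c (lift i j)) *: g (lift i j).
  have := c0; rewrite (bigD1_ord i) //= => /eqP; rewrite addr_eq0 => /eqP gi.
  rewrite -[LHS]scale1r -(mulVf ci0) -scalerA gi scalerN scaler_sumr -sumrN.
  by apply: eq_bigr => j _; rewrite scalerA mulNr scaleNr.
have [b bP] := gP x.
exists (fun j => b (lift i j) - b i * (c i)^-1 * c (lift i j)).
rewrite bP (bigD1_ord i) //= gi scaler_sumr -big_split /=.
apply: eq_bigr => j _; rewrite scalerA -scalerDl mulrA mulrN mulNr addrC.
by [].
Qed.

Lemma vect_coordinates M :
  exists n (v : vect M -> 'rV[F]_n), linear v /\ bijective v.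
Proof.
have exn := spanned_exists M.
case: (ex_minnP exn) => n /asboolP[g gP] n_min; exists n.
have g_free : forall c : 'I_n -> F, \sum_i c i *: g i = 0 -> forall i, c i = 0.
  apply: free_of_minimal gP _ => m h hP.
  by apply: n_min; apply/asboolP; exists h.
pose f (c : 'rV[F]_n) : vect M := \sum_i c 0 i *: g i.
have f_lin : linear f.
  move=> a c d; rewrite /f scaler_sumr -big_split /=; apply: eq_bigr => i _.
  by rewrite !mxE scalerDl scalerA.
pose fL : {linear 'rV[F]_n -> vect M} :=
  HB.pack f (GRing.isLinear.Build F 'rV[F]_n (vect M) *:%R f f_lin).
have /choice[h hP] : forall x, exists c, f c = x.
  move=> x; have [c ->] := gP x; exists (\row_i c i).
  by apply: eq_bigr => i _; rewrite mxE.
have fK : cancel f h.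
  move=> c; apply/eqP; rewrite -subr_eq0; apply/eqP/rowP => i.
  rewrite [RHS]mxE; apply: (g_free (fun j => (h (f c) - c) 0 j)).
  by rewrite -[LHS]/(fL _) linearB /= hP subrr.
by exists h; split; [exact: (can2_linear (f := fL)) | exists f].
Qed.

Lemma vect_axiom M : {n & Vector.axiom n (vect M)}.
Proof.
have [n /cid[v [v_lin v_bij]]] := cid (vect_coordinates M).
by exists n, v.
Qed.

HB.instance Definition _ M :=
  Lmodule_hasFinDim.Build F (vect M) (projT2 (vect_axiom M)).

Definition dim M : nat := \dim {:vect M}.

Lemma vect_linear M N (f : {linear M -> N}) : linear (f : vect M -> vect N).
Proof. by move=> a x y; exact: linearP. Qed.

Definition vlin M N (f : {linear M -> N}) : {linear vect M -> vect N} :=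
  HB.pack (f : vect M -> vect N)
    (GRing.isLinear.Build F (vect M) (vect N) *:%R _ (vect_linear f)).

Definition vmap M N (f : {linear M -> N}) : 'Hom(vect M, vect N) :=
  linfun (vlin f).

Lemma vmapE M N (f : {linear M -> N}) x : vmap f x = f x.
Proof. by rewrite lfunE. Qed.

Definition rank M N (f : {linear M -> N}) : nat := \dim (limg (vmap f)).

Lemma rank_dim M N (f : {linear M -> N}) : (rank f <= dim N)%N.
Proof. by apply: dimvS; exact: subvf. Qed.

Lemma vmap_comp M N P (f : {linear M -> N}) (g : {linear N -> P}) :
  vmap (g \o f) = (vmap g \o vmap f)%VF.
Proof. by apply/lfunP => x; rewrite comp_lfunE !vmapE. Qed.

Lemma rank_compl M N P (f : {linear M -> N}) (g : {linear N -> P}) :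
  (rank (g \o f) <= rank g)%N.
Proof. by rewrite /rank vmap_comp limg_comp dimvS // limgS // subvf. Qed.

Lemma rank_compr M N P (f : {linear M -> N}) (g : {linear N -> P}) :
  (rank (g \o f) <= rank f)%N.
Proof.
by rewrite /rank vmap_comp limg_comp -(limg_ker_dim (vmap g) (limg _)) leq_addl.
Qed.

Lemma rank_eq0 M N (f : {linear M -> N}) : rank f = 0%N -> forall x, f x = 0.
Proof.
move=> /eqP; rewrite dimv_eq0 => /eqP f0 x.
have : vmap f x \in limg (vmap f) by rewrite memv_img ?memvf.
by rewrite f0 memv0 vmapE => /eqP.
Qed.

Lemma rank_zero M N (f : {linear M -> N}) : (forall x, f x = 0) -> rank f = 0%N.
Proof.
move=> f0; apply/eqP; rewrite dimv_eq0 -subv0.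
apply/subvP => _ /memv_imgP[x _ ->].
by rewrite vmapE f0 mem0v.
Qed.

Lemma eq_rank M N (f g : {linear M -> N}) :
  (forall x, f x = g x) -> rank f = rank g.
Proof.
by move=> fg; congr (\dim (limg _)); apply/lfunP => x; rewrite !vmapE.
Qed.

Lemma rank_comp_ker M N P (f : {linear M -> N}) (g : {linear N -> P}) :
  rank (g \o f) = rank f -> forall x, g (f x) = 0 -> f x = 0.
Proof.
rewrite /rank vmap_comp limg_comp => rk x gfx0.
have := limg_ker_dim (vmap g) (limg (vmap f)).
rewrite rk => /eqP; rewrite -[X in _ == X]add0n eqn_add2r dimv_eq0 => /eqP K0.
have : vmap f x \in (limg (vmap f) :&: lker (vmap g))%VS.
  by rewrite memv_cap memv_img ?memvf // memv_ker !vmapE gfx0 eqxx.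
by rewrite K0 memv0 vmapE => /eqP.
Qed.

Lemma rank_comp_img M N P (f : {linear M -> N}) (g : {linear N -> P}) :
  rank (g \o f) = rank g -> forall y, exists x, g (f x) = g y.
Proof.
rewrite /rank vmap_comp => rk y.
have /eqP E : limg (vmap g \o vmap f)%VF == limg (vmap g).
  by rewrite eqEdim rk leqnn limg_comp limgS ?subvf.
have : vmap g y \in limg (vmap g \o vmap f)%VF by rewrite E memv_img ?memvf.
by case/memv_imgP=> x _; rewrite comp_lfunE !vmapE => ->; exists x.
Qed.

Lemma indecomposable_rank X Y Z (f : {linear X -> Y}) (g : {linear Y -> Z}) :
  indecomposable Y -> rank (g \o f) = rank f -> rank (g \o f) = rank g ->
  (0 < rank f)%N -> surj f /\ injective g.
Proof.
move=> indY rkf rkg f_gt0.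
have [||f0|//] := indecomposable_middle (f := f) (g := g) indY.
- exact: rank_comp_ker.
- exact: rank_comp_img.
by move: f_gt0; rewrite (rank_zero f0).
Qed.

Lemma injective_rank M N (f : {linear M -> N}) : injective f -> rank f = dim M.
Proof.
move=> f_inj; rewrite /rank limg_dim_eq //; apply/eqP.
rewrite capfv; apply/lker0P => x y; rewrite !vmapE; exact: f_inj.
Qed.

Lemma surj_rank M N (f : {linear M -> N}) : rank f = dim N -> surj f.
Proof.
move=> rk y; have /eqP E : limg (vmap f) == fullv.
  by rewrite eqEdim subvf -[X in (_ <= X)%N]/(rank f) rk leqnn.
have : (y : vect N) \in limg (vmap f) by rewrite E memvf.
by case/memv_imgP=> x _; rewrite vmapE => ->; exists x.
Qed.

Lemma injective_dim M N (f : {linear M -> N}) :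
  injective f -> (dim M <= dim N)%N.
Proof. by move/injective_rank <-; exact: rank_dim. Qed.

Lemma injective_dim_lt M N (f : {linear M -> N}) :
  injective f -> ~ surj f -> (dim M < dim N)%N.
Proof.
move=> f_inj Nsurj; rewrite ltn_neqAle (injective_dim f_inj) andbT.
by apply/eqP => E; apply/Nsurj/surj_rank; rewrite injective_rank.
Qed.

(** This induction on the dimension stands in for the decomposition of modules
    into indecomposables. *)
Lemma fgmod_ind (P : fgmod -> Prop) :
  (forall M N, iso M N -> P M -> P N) -> P (mod0 _) ->
  (forall M N, P M -> P N -> P (modD M N)) ->
  (forall M, indecomposable M -> P M) -> forall M, P M.
Proof.
move=> Piso P0 PD Pind M; have [n] := ubnP (dim M).
elim: n M => // n IHn M /ltnSE dimM.
have [M0|nM0] := EM (is_zero M); first exact: Piso (iso_sym (iso0 M0)) P0.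
have [indM|nindM] := EM (indecomposable M); first exact: Pind.
have [N [N' [isoM nN nN']]] : exists N N',
    [/\ iso M (modD N N'), ~ is_zero N & ~ is_zero N'].
  apply: contrapT => none; apply: nindM; split=> // N N' isoM.
  have [|nN] := EM (is_zero N); first by left.
  have [|nN'] := EM (is_zero N'); first by right.
  by case: none; exists N, N'.
have [phi /bij_inverse[psi [phiK psiK]]] := isoM.
have smallN : (dim N < dim M)%N.
  apply: (@injective_dim_lt _ _ (psi \o inlL N N')).
    by move=> x y /(can_inj psiK)[].
  move=> hs; apply: nN' => b; have [a /(congr1 phi)] := hs (psi (0, b)).
  by rewrite /= !psiK => -[].
have smallN' : (dim N' < dim M)%N.
  apply: (@injective_dim_lt _ _ (psi \o inrL N N')).
    by move=> x y /(can_inj psiK)[].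
  move=> hs; apply: nN => a; have [b /(congr1 phi)] := hs (psi (a, 0)).
  by rewrite /= !psiK => -[].
apply: Piso (iso_sym isoM) _; apply: PD; apply: IHn.
  exact: leq_trans smallN dimM.
exact: leq_trans smallN' dimM.
Qed.

Lemma iso_dim M N : iso M N -> (dim M <= dim N)%N.
Proof. by case=> f /bij_inj/injective_dim. Qed.

(** * The Harada-Sai lemma and its consequences *)

Section HaradaSai.
Variable b : nat.

Definition bounded_indec M := indecomposable M /\ (dim M <= b)%N.

(** A variant of the [n]-th power of the radical that keeps single composites
    instead of their sums, as the Harada-Sai bound concerns composites.  The
    last factor is arbitrary, which makes [n = 0] the start of the induction. *)
Fixpoint radical_power n X Y (f : {linear X -> Y}) : Prop :=
  if n is n'.+1 then
    exists Z (h : {linear X -> Z}) (k : {linear Z -> Y}),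
      [/\ bounded_indec Z, ~ bijective h, radical_power n' k
        & forall x, f x = k (h x)]
  else True.

Lemma radical_power_split m n X Y (f : {linear X -> Y}) :
  bounded_indec X -> radical_power (m + n.+1) f ->
  exists Z Z' (f1 : {linear X -> Z}) (g : {linear Z -> Z'})
         (f2 : {linear Z' -> Y}),
    [/\ bounded_indec Z, bounded_indec Z', radical_power m f1,
      ~ bijective g & radical_power n f2] /\ forall x, f x = f2 (g (f1 x)).
Proof.
elim: m X f => [|m IHm] X f indX /=.
  by case=> Z [h [k [? ? ? ?]]]; exists X, Z, idfun, h, k.
case=> W [h [k [indW hN /IHm-/(_ indW)]]].
case=> Z [Z' [f1 [g [f2 [[? ? ? ? ?] kE]]]]] fE.
exists Z, Z', (f1 \o h), g, f2; split=> [|x]; last by rewrite fE kE.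
by split=> //; exists W, h, f1.
Qed.

(** A composite that is an isomorphism makes [f] a split monomorphism into an
    indecomposable module, hence an isomorphism. *)
Lemma bijective_factor X Y Z (f : {linear X -> Y}) (g : {linear Y -> Z}) :
  ~ is_zero X -> indecomposable Y -> bijective (g \o f) -> bijective g.
Proof.
move=> X0 indY /(@bij_inverse _ _ _ (g \o f))[u [uK Ku]].
have [|f_bij _] := @retract_indecomposable _ X Y f (u \o g) X0 indY.
  by move=> x; exact: uK.
have [f' [fK f'K]] := bij_inverse f_bij.
exists (f \o u) => [y|z]; last exact: Ku.
by rewrite -{1}(f'K y) /= [u _]uK f'K.
Qed.

(** By definition a factor is added at the source; for [n = 0] adding one at the
    target needs [bijective_factor], as [f] is then arbitrary. *)
Lemma radical_power_rcons n X Y Z (f : {linear X -> Y}) (g : {linear Y -> Z}) :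
  ~ is_zero X -> indecomposable Y -> bounded_indec Z -> radical_power n f ->
  ~ bijective g -> radical_power n.+1 (g \o f).
Proof.
move=> X0 indY indZ + gN; elim: n X f X0 => [|n IHn] X f X0 /= => [_|].
  exists Z, (g \o f), idfun; split=> // /bijective_factor.
  by apply: contra_not gN; apply.
case=> W [h [k [indW hN kn fE]]]; exists W, h, (g \o k).
by split=> [//|//||x]; [apply: IHn => //; case: indW => [[]] | rewrite /= fE].
Qed.

(** Write a composite of [2 ^ m.+1 - 1] maps as [f2 \o g \o f1] with [2 ^ m - 1]
    maps in each of [f1] and [f2].  By induction [f1] and [f2] have rank at most
    [b - m].  If the composite also had rank [b - m > 0], then so would
    [f1], [g \o f1], [f2 \o g] and [f2]; the middle modules being
    indecomposable, [f2 \o g] would be injective and [g \o f1] surjective, so that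
    the non-isomorphism [g] would be bijective. *)
Lemma harada_sai m X Y (f : {linear X -> Y}) :
  bounded_indec X -> bounded_indec Y -> radical_power (2 ^ m).-1 f ->
  (rank f <= b - m)%N.
Proof.
elim: m X Y f => [|m IHm] X Y f indX indY.
  by move=> _; rewrite subn0; apply: leq_trans (rank_dim f) (proj2 indY).
have -> : ((2 ^ m.+1).-1 = (2 ^ m).-1 + (2 ^ m).-1.+1)%N.
  rewrite prednK ?expn_gt0 // expnS mul2n -addnn.
  by case: (2 ^ m)%N (expn_gt0 2 m).
case/radical_power_split=> // Z [Z' [f1 [g [f2 [[indZ indZ' r1 gN r2] fE]]]]].
have rk1 := IHm _ _ _ indX indZ r1; have rk2 := IHm _ _ _ indZ' indY r2.
have fE' : rank f = rank (f2 \o (g \o f1)) by apply: eq_rank.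
have fE'' : rank f = rank ((f2 \o g) \o f1) by apply: eq_rank.
have le1 : (rank f <= rank f1)%N by rewrite fE'' rank_compr.
have le2 : (rank f <= rank f2)%N by rewrite fE' rank_compl.
rewrite leqNgt subnS; apply/negP => big.
have rkf_gt0 : (0 < rank f)%N by apply: leq_ltn_trans big.
have eqf : rank f = (b - m)%N.
  apply/eqP; rewrite eqn_leq (leq_trans le1 rk1) /=.
  by move: big; case: (b - m)%N.
have e1 : rank f1 = rank f by apply/eqP; rewrite eqn_leq le1 andbT eqf.
have e2 : rank f2 = rank f by apply/eqP; rewrite eqn_leq le2 andbT eqf.
have e21 : rank (f2 \o g) = rank f.
  by apply/eqP; rewrite eqn_leq -{1}e2 rank_compl fE'' rank_compl.
have e12 : rank (g \o f1) = rank f.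
  by apply/eqP; rewrite eqn_leq -{1}e1 rank_compr fE' rank_compr.
have [||| _ g_inj] :=
  indecomposable_rank (f := f1) (g := f2 \o g) (proj1 indZ).
- by rewrite -fE'' e1.
- by rewrite -fE'' e21.
- by rewrite e1.
have [|||g_surj _] :=
  indecomposable_rank (f := g \o f1) (g := f2) (proj1 indZ').
- by rewrite -fE' e12.
- by rewrite -fE' e2.
- by rewrite e12.
apply/gN/inj_surj_bij; first exact: inj_compr g_inj.
by move=> y; have [x <-] := g_surj y; exists (f1 x).
Qed.

Lemma radical_nilpotent X Y (f : {linear X -> Y}) :
  bounded_indec X -> bounded_indec Y -> radical_power (2 ^ b).-1 f ->
  forall x, f x = 0.
Proof.
move=> indX indY /harada_sai rk; apply: rank_eq0; apply/eqP.
by rewrite -leqn0 -(subnn b) rk.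
Qed.

End HaradaSai.

(** The powers of [f] are composites of non-isomorphisms of [X]. *)
Lemma fitting_nilpotent X (f : {linear X -> X}) :
  indecomposable X -> ~ bijective f -> exists n, forall x, iter n f x = 0.
Proof.
move=> indX fN; exists (2 ^ dim X).-1 => x; set n := _.-1.
pose fix power m : {linear X -> X} :=
  if m is m'.+1 then power m' \o f else idfun.
have powerE m y : power m y = iter m f y.
  by elim: m y => //= m IHm y; rewrite IHm -iterSr.
have bX : bounded_indec (dim X) X by [].
rewrite -powerE; apply: (radical_nilpotent bX bX); rewrite -/n.
by elim: n => //= m IHm; exists X, f, (power m).
Qed.

(** If neither map is bijective then both are nilpotent; but on the kernel of
    [f] the map [g] is the identity, so this kernel vanishes and [f] is
    injective, which contradicts its nilpotency. *)
Lemma indecomposable_local X (f g : {linear X -> X}) :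
  indecomposable X -> (forall x, f x + g x = x) -> bijective f \/ bijective g.
Proof.
move=> indX fg1; have [|fN] := EM (bijective f); first by left.
right; apply: contrapT => gN.
have [m fm0] := fitting_nilpotent indX fN.
have [n gn0] := fitting_nilpotent indX gN.
case: (proj1 indX) => x; elim: m fm0 x => [|m IHm] fm0; first exact: fm0.
apply: IHm => x; set y := iter m f x.
have fy0 : f y = 0 by exact: fm0.
have gy : g y = y by rewrite -[RHS]fg1 fy0 add0r.
by rewrite -(gn0 y); elim: n {gn0} => //= n <-.
Qed.

(** The identity of [X] is the sum of its two parts factoring through [M] and
    through [N]; by locality one of them is an automorphism. *)
Lemma retract_modD X M N : indecomposable X ->
  retract X (modD M N) -> retract X M \/ retract X N.
Proof.
move=> indX [s [r sK]].
pose f : {linear X -> X} := r \o inlL M N \o fstL M N \o s.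
pose g : {linear X -> X} := r \o inrL M N \o sndL M N \o s.
have [||] := indecomposable_local (f := f) (g := g) indX.
- by move=> x; rewrite /f /g /= -linearD -pairD sK.
- case/bij_inverse=> u [uK _]; left.
  by exists (fstL M N \o s), (u \o (r \o inlL M N)); exact: uK.
case/bij_inverse=> u [uK _]; right.
by exists (sndL M N \o s), (u \o (r \o inrL M N)); exact: uK.
Qed.

Lemma retract_iso X Y : indecomposable X -> indecomposable Y ->
  retract X Y -> iso X Y.
Proof.
move=> [X0 _] indY [s [r sK]].
by have [s_bij _] := retract_indecomposable X0 indY sK; exists s.
Qed.

(** * Finite direct sums *)

Lemma finite_dsum1 (S : fgmod -> Prop) M :
  S M -> finite_dsum S (modD M (mod0 _)).
Proof. by move=> SM; apply: finite_dsumD SM _; exact: finite_dsum0. Qed.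

(** [finite_dsum] builds sums in the form [M1 + (M2 + (.. + 0))], so a sum of
    two of them is such a sum only up to isomorphism. *)
Lemma finite_dsum_cat (S : fgmod -> Prop) M N :
  finite_dsum S M -> finite_dsum S N ->
  exists2 K, finite_dsum S K & retract (modD M N) K.
Proof.
move=> dM; elim: dM N => [|M1 M2 SM1 _ IH] N dN.
  exists N => //; exists (sndL _ _), (inrL _ _) => -[a c].
  by congr pair; rewrite (mod0_is_zero a).
have [K dK [s [r sK]]] := IH N dN.
exists (modD M1 K); first exact: finite_dsumD.
exists (pairL (fstL M1 M2 \o fstL _ _)
   (s \o pairL (sndL M1 M2 \o fstL _ _) (sndL _ _))).
exists (pairL (pairL (fstL M1 K) (fstL M2 N \o r \o sndL M1 K))
  (sndL M2 N \o r \o sndL M1 K)) => -[[a c] d].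
by rewrite /= sK.
Qed.

Lemma add_modD (S : fgmod -> Prop) M N :
  Defs.add S M -> Defs.add S N -> Defs.add S (modD M N).
Proof.
case=> M' dM' /summand_retract[s [r sK]] [N' dN' /summand_retract[s' [r' s'K]]].
have [K dK rK] := finite_dsum_cat dM' dN'; exists K => //.
apply/retract_summand/(retract_trans _ rK).
exists (pairL (s \o fstL M N) (s' \o sndL M N)).
exists (pairL (r \o fstL M' N') (r' \o sndL M' N')) => -[a c].
by rewrite /= sK s'K.
Qed.

Lemma finite_dsum_sub (S C : fgmod -> Prop) M :
  subcategory C -> (forall N, S N -> C N) -> finite_dsum S M -> C M.
Proof. by case=> C0 CD _ _ SC; elim=> // N N' /SC CN _; exact: CD. Qed.

Lemma finite_dsum_none (S : fgmod -> Prop) M :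
  (forall N, ~ S N) -> finite_dsum S M -> is_zero M.
Proof. by move=> S0 [|N N' /S0[]]; exact: mod0_is_zero. Qed.

Lemma subcat_le (D E : fgmod -> Prop) :
  (forall M N, iso M N -> D M -> D N) ->
  (forall M N, D (modD M N) -> D M /\ D N) ->
  (forall M N, iso M N -> E M -> E N) -> E (mod0 _) ->
  (forall M N, E M -> E N -> E (modD M N)) ->
  (forall Z, indecomposable Z -> D Z -> E Z) -> forall M, D M -> E M.
Proof.
move=> Diso Dsum Eiso E0 ED Eind; apply: fgmod_ind => //.
  by move=> M N isoM IH DN; apply/(Eiso _ _ isoM)/IH/(Diso _ _ (iso_sym isoM)).
by move=> M N IHM IHN /Dsum[DM DN]; apply: ED; [apply: IHM | apply: IHN].
Qed.

Lemma subcategory_summands (C : fgmod -> Prop) M N :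
  subcategory C -> C (modD M N) -> C M /\ C N.
Proof.
case=> _ _ _ Csum CMN; split; apply: Csum CMN; apply: retract_summand.
  exact: retractDl.
exact: retractDr.
Qed.

Lemma subcategory_retract (C : fgmod -> Prop) M N :
  subcategory C -> retract M N -> C N -> C M.
Proof. by case=> _ _ _ Csum /retract_summand; exact: Csum. Qed.

(** * Traces of splitting projectives *)

(** The trace of [S] in [M], that is, the sum of the images of all maps to [M]
    from modules in [S], given by its elements. *)
Definition trace (S : fgmod -> Prop) M (x : M) : Prop :=
  exists P (f : {linear P -> M}), finite_dsum S P /\ exists p, f p = x.

Section Trace.
Variable S : fgmod -> Prop.

Lemma trace_gen P M (f : {linear P -> M}) p : S P -> trace S (f p).
Proof.
move=> SP; exists _, (f \o fstL P (mod0 _)); split; first exact: finite_dsum1.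
by exists (p, 0).
Qed.

Lemma trace0 M : trace S (0 : M).
Proof.
by exists (mod0 _), (zeroL _ M); split; [exact: finite_dsum0 | exists 0].
Qed.

Lemma trace_join P Q M (f : {linear P -> M}) (g : {linear Q -> M}) :
  finite_dsum S P -> finite_dsum S Q ->
  exists K (h : {linear K -> M}), finite_dsum S K /\
    forall p q, exists k, h k = f p + g q.
Proof.
move=> dP dQ; have [K dK [s [r sK]]] := finite_dsum_cat dP dQ.
exists K, (copair f g \o r); split=> // p q; exists (s (p, q)).
by rewrite /= sK.
Qed.

Lemma traceD M (x y : M) : trace S x -> trace S y -> trace S (x + y).
Proof.
case=> P [f [dP [p <-]]] [Q [g [dQ [q <-]]]].
by have [K [h [dK hP]]] := trace_join f g dP dQ; exists K, h.
Qed.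

Lemma trace_map M N (f : {linear M -> N}) x : trace S x -> trace S (f x).
Proof.
by case=> P [g [dP [p <-]]]; exists P, (f \o g); split=> //; exists p.
Qed.

(** Each of the finitely many generators of [M] is reached from one finite sum,
    and these sums can be joined into one. *)
Lemma trace_surj M : (forall x : M, trace S x) ->
  exists2 P, finite_dsum S P & exists f : {linear P -> M}, surj f.
Proof.
move=> trM; have [n [g gP]] := fgmodP M.
have [P [f [dP fg]]] : exists P (f : {linear P -> M}),
    finite_dsum S P /\ forall i, exists p, f p = g i.
  elim: n g {gP} => [|n IHn] g.
    by exists (mod0 _), (zeroL _ M); split; [exact: finite_dsum0 | case].
  have [P [f [dP fg]]] := IHn (fun i => g (lift ord0 i)).
  have [Q [h [dQ [q hq]]]] := trM (g ord0).
  have [K [k [dK kP]]] := trace_join f h dP dQ; exists K, k; split=> // i.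
  have [j ->|->] := unliftP ord0 i.
    have [p <-] := fg j; have [z kz] := kP p 0.
    by exists z; rewrite kz linear0 addr0.
  by have [z kz] := kP 0 q; exists z; rewrite kz linear0 add0r.
exists P => //; exists f => x; have [c ->] := gP x.
have [h hP] := choice fg; exists (\sum_i c i *: h i).
by rewrite linear_sum; apply: eq_bigr => i _; rewrite linearZ hP.
Qed.

End Trace.

(** * Detecting elements by splitting injectives *)

Definition detected (S : fgmod -> Prop) M (x : M) : Prop :=
  exists Q (f : {linear M -> Q}), S Q /\ f x <> 0.

(** As long as a map to a finite sum has a nonzero element in its kernel, adding
    a component that detects this element decreases the dimension of the
    kernel. *)
Lemma detected_inj (S : fgmod -> Prop) M :
  (forall x : M, x <> 0 -> detected S x) ->
  exists2 Q, finite_dsum S Q & exists f : {linear M -> Q}, injective f.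
Proof.
move=> detM.
suff {} : forall n P (f : {linear M -> P}), finite_dsum S P ->
    (\dim (lker (vmap f)) < n)%N ->
    exists2 Q, finite_dsum S Q & exists f : {linear M -> Q}, injective f.
  apply; first exact: finite_dsum0.
  exact: (ltnSn (\dim (lker (vmap (zeroL M _))))).
elim=> // n IHn P f dP /ltnSE dimf.
have [f_inj|] := EM (injective f); first by exists P => //; exists f.
move=> f_ninj; have [x [fx0 x0]] : exists x, f x = 0 /\ x <> 0.
  apply: contrapT => none; apply: f_ninj; apply: linear_inj => x fx0.
  by apply: contrapT => x0; apply: none; exists x.
have [Q [g [SQ gx0]]] := detM x x0.
apply: (IHn (modD Q P) (pairL g f)); first exact: finite_dsumD.
apply: leq_trans dimf; rewrite ltnNge; apply/negP => le.
have sub : (lker (vmap (pairL g f)) <= lker (vmap f))%VS.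
  by apply/subvP => y; rewrite !memv_ker !vmapE => /eqP[_ ->].
have /eqP eqk : lker (vmap (pairL g f)) == lker (vmap f) by rewrite eqEdim sub.
apply: gx0; have : (x : vect M) \in lker (vmap f) by rewrite memv_ker vmapE fx0.
by rewrite -eqk memv_ker vmapE => /eqP[].
Qed.

(** * Descent along the radical *)

Section Descent.
Variables (b : nat) (C : fgmod -> Prop).
Hypothesis b_bound : forall X, indecomposable X -> (dim X <= b)%N.
Hypothesis subC : subcategory C.

Let bounded X : indecomposable X -> bounded_indec b X.
Proof. by move=> indX; split=> //; exact: b_bound. Qed.

Let C_iso M N : iso M N -> C N -> C M.
Proof. by case: subC => _ _ Ciso _ /iso_sym; exact: Ciso. Qed.

(** Descending induction on [n], where [k] counts the steps that remain until
    the composites vanish.  If [Y] is not a splitting projective, its elements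
    are sums of values of non-isomorphisms [h : Z -> Y], and [f \o h] lies one step
    deeper in the radical. *)
Lemma radical_trace k n X Y (f : {linear Y -> X}) :
  (n + k)%N = (2 ^ b).-1 -> indecomposable X -> indecomposable Y -> C Y ->
  radical_power b n f -> forall y, trace (splitting_projective C) (f y).
Proof.
elim: k n X Y f => [|k IHk] n X Y f nk indX indY CY radf y.
  rewrite addn0 in nk; rewrite nk in radf.
  rewrite (radical_nilpotent (bounded indY) (bounded indX) radf).
  exact: trace0.
have [sY|nsY] := EM (splitting_projective C Y); first exact: trace_gen.
have [M [h [CM h_surj hN]]] : exists M (h : {linear M -> Y}),
    [/\ C M, surj h & ~ exists s : {linear Y -> M}, cancel s h].
  apply: contrapT => none; apply: nsY; split=> // M h CM h_surj.
  by apply: contrapT => hN; apply: none; exists M, h.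
(* Surjectivity of [h] does not pass to the summands of [M], but not being split
   does. *)
have [m <-] := h_surj y; elim/fgmod_ind: M CM h hN m {h_surj}.
- move=> M N isoM IHM CN h hN m.
  have [phi /bij_inverse[psi [phiK psiK]]] := isoM.
  rewrite -(psiK m); apply: (IHM (C_iso isoM CN) (h \o phi)).
  by case=> s sK; apply: hN; exists (phi \o s).
- by move=> _ h _ m; rewrite (mod0_is_zero m) !linear0; exact: trace0.
- move=> M N IHM IHN /(subcategory_summands subC)[CM CN] h hN m.
  rewrite (pairD m) !linearD; apply: traceD.
    apply: (IHM CM (h \o inlL M N)).
    by case=> s sK; apply: hN; exists (inlL M N \o s).
  apply: (IHN CN (h \o inrL M N)).
  by case=> s sK; apply: hN; exists (inrL M N \o s).
move=> Z indZ CZ h hN m; apply: (IHk n.+1 _ _ (f \o h)) => //.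
  by rewrite addSnnS.
exists Y, h, f; split=> //; first exact: bounded.
by case/bij_inverse=> s [_ sK]; apply: hN; exists s.
Qed.

Lemma trace_all M : C M -> forall x : M, trace (splitting_projective C) x.
Proof.
elim/fgmod_ind: M.
- move=> M N isoM IHM CN x; have [phi /bij_inverse[psi [phiK psiK]]] := isoM.
  by rewrite -(psiK x); apply: trace_map; apply: IHM; apply: C_iso isoM CN.
- by move=> _ x; rewrite (mod0_is_zero x); exact: trace0.
- move=> M N IHM IHN /(subcategory_summands subC)[CM CN] x.
  rewrite (pairD x).
  by apply: traceD; apply: trace_map; [exact: IHM | exact: IHN].
move=> X indX CX x.
exact: (@radical_trace (2 ^ b).-1 0 X X idfun (add0n _) indX indX CX I).
Qed.

(** The dual of [radical_trace]: if [Y] is not a splitting injective, then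
    [f x] has a nonzero image under some non-isomorphism [h : Y -> Z]. *)
Lemma radical_detected k n X Y (f : {linear X -> Y}) :
  (n + k)%N = (2 ^ b).-1 -> indecomposable X -> indecomposable Y -> C Y ->
  radical_power b n f ->
  forall x, f x <> 0 -> detected (splitting_injective C) x.
Proof.
elim: k n X Y f => [|k IHk] n X Y f nk indX indY CY radf x fx0.
  rewrite addn0 in nk; rewrite nk in radf.
  by case: fx0; exact: (radical_nilpotent (bounded indX) (bounded indY) radf).
have [sY|nsY] := EM (splitting_injective C Y); first by exists Y, f.
have [M [h [CM h_inj hN]]] : exists M (h : {linear Y -> M}),
    [/\ C M, injective h & ~ exists r : {linear M -> Y}, cancel h r].
  apply: contrapT => none; apply: nsY; split=> // M h CM h_inj.
  by apply: contrapT => hN; apply: none; exists M, h.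
have : h (f x) <> 0 by move=> hfx0; apply/fx0/h_inj; rewrite hfx0 linear0.
elim/fgmod_ind: M CM h hN {h_inj}.
- move=> M N isoM IHM CN h hN; have [phi /bij_inverse[psi [phiK psiK]]] := isoM.
  move=> hfx0; apply: (IHM (C_iso isoM CN) (psi \o h)).
    by case=> r rK; apply: hN; exists (r \o psi).
  by move=> /= E; apply: hfx0; rewrite -(psiK (h _)) E linear0.
- by move=> _ h _ []; exact: mod0_is_zero.
- move=> M N IHM IHN /(subcategory_summands subC)[CM CN] h hN hfx0.
  have [h1|h1] := EM ((h (f x)).1 = 0); last first.
    apply: (IHM CM (fstL M N \o h)) => //.
    by case=> r rK; apply: hN; exists (r \o fstL M N).
  apply: (IHN CN (sndL M N \o h)).
    by case=> r rK; apply: hN; exists (r \o sndL M N).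
  by move=> h2; apply: hfx0; rewrite (pairD (h _)) h1 [_.2]h2 !linear0 addr0.
move=> Z indZ CZ h hN; apply: (IHk n.+1 _ _ (h \o f)) => //.
  by rewrite addSnnS.
apply: radical_power_rcons => //; first exact: (proj1 indX).
  exact: bounded.
by case/bij_inverse=> r [rK _]; apply: hN; exists r.
Qed.

Lemma detected_all M :
  C M -> forall x : M, x <> 0 -> detected (splitting_injective C) x.
Proof.
elim/fgmod_ind: M.
- move=> M N isoM IHM CN x x0; have [phi /bij_inverse[psi [phiK psiK]]] := isoM.
  have [|Q [f [SQ fx0]]] := IHM (C_iso isoM CN) (psi x).
    by move=> E; apply: x0; rewrite -(psiK x) E linear0.
  by exists Q, (f \o psi).
- by move=> _ x []; exact: mod0_is_zero.
- move=> M N IHM IHN /(subcategory_summands subC)[CM CN] [x y] xy0.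
  have [x0|x0] := EM (x = 0); last first.
    by have [Q [f [SQ fx]]] := IHM CM x x0; exists Q, (f \o fstL M N).
  have [|Q [f [SQ fy]]] := IHN CN y; last by exists Q, (f \o sndL M N).
  by move=> y0; apply: xy0; rewrite x0 y0.
move=> X indX CX x x0.
exact: (@radical_detected (2 ^ b).-1 0 X X idfun (add0n _) indX indX CX I).
Qed.

End Descent.

(** * Deleting an indecomposable *)

Section Deletion.
Variables (I : finType) (ind : I -> fgmod).
Hypothesis ind_repr : ind_representatives ind.

Lemma indecomposable_dim_bounded :
  exists b, forall X, indecomposable X -> (dim X <= b)%N.
Proof.
have [_ _ indP] := ind_repr; exists (\max_i dim (ind i)) => X /indP[i isoX].
exact: leq_trans (iso_dim isoX) (leq_bigmax i).
Qed.

Lemma in_ind_of (C : fgmod -> Prop) i : (i \in ind_of ind C) = `[< C (ind i) >].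
Proof. by rewrite inE. Qed.

(** [delete] is defined through the chosen representatives; this description in
    terms of [X] alone makes it evident how deletion behaves under surjections
    and injections. *)
Lemma deleteP (C : fgmod -> Prop) X M : subcategory C -> indecomposable X ->
  delete ind C X M <-> C M /\ ~ retract X M.
Proof.
move=> subC indX; have [ind_indec _ indP] := ind_repr.
have [C0 CD Ciso _] := subC; split.
  case=> N dN /summand_retract rMN.
  suff [CN XN] : C N /\ ~ retract X N.
    split; first exact: subcategory_retract rMN CN.
    by move=> rXM; apply/XN/(retract_trans rXM).
  elim: dN => [|M1 N1 [i [iC iX ->]] _ [CN1 XN1]].
    by split=> // /retract_mod0; exact: (proj1 indX).
  split; first by apply: CD => //; apply/asboolP; rewrite -in_ind_of.
  case/(retract_modD indX) => // /(retract_iso indX (ind_indec i)) /iso_sym.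
  exact: iX.
case=> CM XM; pose D N := C N /\ ~ retract X N.
apply: (@subcat_le D (delete ind C X)) (conj CM XM).
- move=> N N' isoN [CN XN]; split; first exact: Ciso isoN CN.
  by move=> rX; apply/XN/(retract_trans rX)/iso_retract/iso_sym.
- move=> N N' [CNN' XNN']; have [CN CN'] := subcategory_summands subC CNN'.
  split; split=> // rX; apply/XNN'/(retract_trans rX).
    exact: retractDl.
  exact: retractDr.
- move=> N N' isoN [K dK rK]; exists K => //.
  apply/retract_summand/(retract_trans (iso_retract (iso_sym isoN))).
  exact: summand_retract.
- exists (mod0 _); first exact: finite_dsum0.
  exact/retract_summand/iso_retract/iso_refl.
- exact: add_modD.
move=> Z indZ [CZ XZ]; have [i isoZ] := indP Z indZ.
exists (modD (ind i) (mod0 _)).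
  apply: finite_dsum1; exists i; split=> //.
    by rewrite in_ind_of; apply/asboolP/(Ciso _ _ isoZ).
  move=> isoX; apply/XZ/iso_retract/iso_sym.
  exact: iso_trans isoX.
apply: retract_summand.
exact: retract_trans (iso_retract isoZ) (retractDl _ _).
Qed.

Lemma delete_subcategory (C : fgmod -> Prop) X :
  subcategory C -> indecomposable X -> subcategory (delete ind C X).
Proof.
move=> subC indX; have [C0 CD Ciso Csum] := subC.
have dP M := deleteP M subC indX.
split=> [|M N /dP[CM XM] /dP[CN XN]|M N isoM /dP[CM XM]|M N sMN /dP[CN XN]];
  apply/dP.
- by split=> // /retract_mod0; exact: (proj1 indX).
- split; first exact: CD.
  by case/(retract_modD indX).
- split; first exact: Ciso isoM CM.
  by move=> rX; apply/XM/(retract_trans rX)/iso_retract/iso_sym.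
split; first exact: Csum sMN CN.
by move=> rX; apply/XN/(retract_trans rX)/summand_retract.
Qed.

(** If [M -> N] is surjective and [X] is a summand of [N], then the composite
    [M -> N -> X] splits, so that [X] is already a summand of [M]. *)
Lemma delete_Lquot (C : fgmod -> Prop) X :
  Lquot C -> splitting_projective C X -> Lquot (delete ind C X).
Proof.
case=> subC quotC [indX CX splitX]; split; first exact: delete_subcategory.
move=> M N f f_surj /(deleteP _ subC indX)[CM XM].
apply/(deleteP _ subC indX); split; first exact: quotC f_surj CM.
case=> s [r sK]; apply: XM.
have [|t tK] := splitX M (r \o f) CM; last by exists t, (r \o f).
by move=> x; have [m fm] := f_surj (s x); exists m; rewrite /= fm.
Qed.

Lemma delete_Lsub (C : fgmod -> Prop) X :
  Lsub C -> splitting_injective C X -> Lsub (delete ind C X).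
Proof.
case=> subC subsC [indX CX splitX]; split; first exact: delete_subcategory.
move=> M N f f_inj /(deleteP _ subC indX)[CN XN].
apply/(deleteP _ subC indX); split; first exact: subsC f_inj CN.
case=> s [r sK]; apply: XN.
have [|t tK] := splitX N (f \o s) CN; last by exists (f \o s), t.
exact: inj_comp f_inj (can_inj sK).
Qed.

(** * Covering relations *)

Lemma ind_of_subset (C C' : fgmod -> Prop) : subcategory C -> subcategory C' ->
  ind_of ind C \subset ind_of ind C' <-> forall M, C M -> C' M.
Proof.
move=> subC [C'0 C'D C'iso _]; have [_ _ Ciso _] := subC.
have [_ _ indP] := ind_repr; split=> [/subsetP sub|CC'].
  apply: subcat_le => //; first by move=> M N; exact: subcategory_summands.
  move=> Z indZ CZ; have [i isoZ] := indP Z indZ.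
  apply: C'iso (iso_sym isoZ) _; apply/asboolP; rewrite -in_ind_of; apply: sub.
  by rewrite in_ind_of; apply/asboolP/(Ciso _ _ isoZ).
by apply/subsetP => i; rewrite !in_ind_of => /asboolP/CC'?; apply/asboolP.
Qed.

(** The argument about coverings, common to quotient-closed subcategories with
    splitting projectives and submodule-closed ones with splitting
    injectives. *)
Section Covering.
Variables (L : (fgmod -> Prop) -> Prop)
          (spl : (fgmod -> Prop) -> fgmod -> Prop).
Hypothesis L_subcategory : forall C, L C -> subcategory C.
Hypothesis spl_indecomposable : forall C X, spl C X -> indecomposable X.
Hypothesis spl_in : forall C X, spl C X -> C X.
Hypothesis delete_L : forall C X, L C -> spl C X -> L (delete ind C X).
Hypothesis spl_generate : forall C C', L C -> L C' ->
  (forall X, spl C X -> C' X) -> forall M, C M -> C' M.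

(** Some [X] with [spl C X] lies outside [C'], since otherwise [C] would be
    contained in [C'].  Then [C'] is contained in the deletion of [X] from [C],
    which is strictly smaller than [C], so the two agree. *)
Lemma covering_card C' C :
  covering L C' C -> #|ind_of ind C :\: ind_of ind C'| = 1%N.
Proof.
case=> LC' LC [C'C nCC'] noD; have [ind_indec ind_inj indP] := ind_repr.
have [X sX nC'X] : exists2 X, spl C X & ~ C' X.
  apply: contrapT => none; apply: nCC'; apply: spl_generate => // X sX.
  by apply: contrapT => nC'X; apply: none; exists X.
have indX := spl_indecomposable sX; have CX := spl_in sX.
have subC := L_subcategory LC; have subC' := L_subcategory LC'.
have [_ _ Ciso _] := subC; have [_ _ C'iso _] := subC'.
have dP M := deleteP M subC indX.
have DC' M : delete ind C X M -> C' M.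
  apply: contrapT => nDC'; apply: noD; exists (delete ind C X).
  split; first exact: delete_L.
    split; last by move=> DC'; apply: nDC'; exact: DC'.
    move=> N C'N; apply/dP; split; first exact: C'C.
    by move=> rX; apply/nC'X/(subcategory_retract subC' rX).
  split; first by move=> N /dP[].
  by move=> /(_ X CX)/dP[_]; apply; apply/iso_retract/iso_refl.
have [i isoX] := indP X indX.
apply/eqP/cards1P; exists i; apply/setP => j; rewrite !inE; apply/andP/eqP.
  case=> /asboolPn nC'j /asboolP Cj; apply: contrapT => ji; apply: nC'j.
  apply: DC'; apply/dP; split=> // /(retract_iso indX (ind_indec j)) isoXj.
  by apply/ji/ind_inj/(iso_trans (iso_sym isoXj)).
move=> ->; split; last by apply/asboolP/(Ciso _ _ isoX).
by apply/asboolPn => C'i; apply/nC'X/(C'iso _ _ (iso_sym isoX)).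
Qed.

Lemma graded_by_size : graded_by L (size_of ind).
Proof.
split=> [C' C LC' LC [C'C nCC']|C' C cov].
  apply: proper_card; rewrite properE; apply/andP; split.
    exact/(ind_of_subset (L_subcategory LC') (L_subcategory LC)).
  by apply/negP => /(ind_of_subset (L_subcategory LC) (L_subcategory LC'))/nCC'.
have [LC' LC [C'C _] _] := cov.
have sub : ind_of ind C' \subset ind_of ind C.
  exact/(ind_of_subset (L_subcategory LC') (L_subcategory LC)).
rewrite /size_of -(cardsID (ind_of ind C') (ind_of ind C)) covering_card //.
by rewrite (setIidPr sub) addn1.
Qed.

End Covering.

(** * Generation and cogeneration *)

Lemma splitting_projectives_generate (C : fgmod -> Prop) M : subcategory C ->
  C M -> exists2 P, finite_dsum (splitting_projective C) P
                  & exists f : {linear P -> M}, surj f.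
Proof.
move=> subC CM; have [b b_bound] := indecomposable_dim_bounded.
exact/trace_surj/(trace_all b_bound).
Qed.

Lemma splitting_injectives_cogenerate (C : fgmod -> Prop) M : subcategory C ->
  C M -> exists2 Q, finite_dsum (splitting_injective C) Q
                  & exists f : {linear M -> Q}, injective f.
Proof.
move=> subC CM; have [b b_bound] := indecomposable_dim_bounded.
exact/detected_inj/(detected_all b_bound).
Qed.

Lemma splitting_projective_exists (C : fgmod -> Prop) : subcategory C ->
  nonzero_subcat C -> exists X, splitting_projective C X.
Proof.
move=> subC [M CM M0]; apply: contrapT => none; apply: M0 => x.
have [P dP [f f_surj]] := splitting_projectives_generate subC CM.
have [p <-] := f_surj x; rewrite (finite_dsum_none _ dP p) ?linear0 //.
by move=> X sX; apply: none; exists X.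
Qed.

Lemma splitting_injective_exists (C : fgmod -> Prop) : subcategory C ->
  nonzero_subcat C -> exists X, splitting_injective C X.
Proof.
move=> subC [M CM M0]; apply: contrapT => none; apply: M0 => x.
have [Q dQ [f f_inj]] := splitting_injectives_cogenerate subC CM.
apply: f_inj; rewrite linear0 (finite_dsum_none _ dQ (f x)) //.
by move=> X sX; apply: none; exists X.
Qed.

Lemma Lquot_le (C C' : fgmod -> Prop) : Lquot C -> Lquot C' ->
  (forall X, splitting_projective C X -> C' X) -> forall M, C M -> C' M.
Proof.
case=> subC _ [subC' quotC'] sC' M CM.
have [P dP [f f_surj]] := splitting_projectives_generate subC CM.
exact: quotC' f_surj (finite_dsum_sub subC' sC' dP).
Qed.

Lemma Lsub_le (C C' : fgmod -> Prop) : Lsub C -> Lsub C' ->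
  (forall X, splitting_injective C X -> C' X) -> forall M, C M -> C' M.
Proof.
case=> subC _ [subC' subsC'] sC' M CM.
have [Q dQ [f f_inj]] := splitting_injectives_cogenerate subC CM.
exact: subsC' f_inj (finite_dsum_sub subC' sC' dQ).
Qed.

End Deletion.
End Dimension.

Theorem corollary2p18 (F : fieldType) (A : falgType F)
    (I : finType) (ind : I -> fgmod A^c) (ind_repr : ind_representatives ind) :
  (* (1) *)
  (forall C : fgmod A^c -> Prop, Lquot C ->
     (nonzero_subcat C -> exists X, splitting_projective C X) /\
     (forall X, splitting_projective C X -> Lquot (delete ind C X))) /\
  (* (2) *)
  ((forall C' C : fgmod A^c -> Prop, covering (@Lquot A^c) C' C ->
      #|ind_of ind C :\: ind_of ind C'| = 1%N) /\
   graded_by (@Lquot A^c) (size_of ind)) /\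
  (* (3) *)
  (forall C : fgmod A^c -> Prop, Lquot C ->
     forall M, C M ->
       exists2 P, finite_dsum (splitting_projective C) P
                & exists f : {linear P -> M}, surj f) /\
  (* (4a) *)
  (forall C : fgmod A^c -> Prop, Lsub C ->
     (nonzero_subcat C -> exists X, splitting_injective C X) /\
     (forall X, splitting_injective C X -> Lsub (delete ind C X))) /\
  (* (4b) *)
  ((forall C' C : fgmod A^c -> Prop, covering (@Lsub A^c) C' C ->
      #|ind_of ind C :\: ind_of ind C'| = 1%N) /\
   graded_by (@Lsub A^c) (size_of ind)) /\
  (* (4c) *)
  (forall C : fgmod A^c -> Prop, Lsub C ->
     forall M, C M ->
       exists2 Q, finite_dsum (splitting_injective C) Q
                & exists f : {linear M -> Q}, injective f).
Proof.
have subQ C : @Lquot A^c C -> subcategory C by case.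
have subS C : @Lsub A^c C -> subcategory C by case.
have indP C X : @splitting_projective A^c C X -> indecomposable X by case.
have indI C X : @splitting_injective A^c C X -> indecomposable X by case.
have inP C X : @splitting_projective A^c C X -> C X by case.
have inI C X : @splitting_injective A^c C X -> C X by case.
have delQ := delete_Lquot ind_repr; have delS := delete_Lsub ind_repr.
have leQ := Lquot_le ind_repr; have leS := Lsub_le ind_repr.
split=> [C LC|].
  split=> [|X]; first exact (splitting_projective_exists ind_repr (subQ C LC)).
  exact: delQ.
split; first split.
- exact (covering_card ind_repr subQ indP inP delQ leQ).
- exact (graded_by_size ind_repr subQ indP inP delQ leQ).
split=> [C LC M|].
  exact (splitting_projectives_generate ind_repr (subQ C LC)).
split=> [C LC|].
  split=> [|X]; first exact (splitting_injective_exists ind_repr (subS C LC)).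
  exact: delS.
split; first split.
- exact (covering_card ind_repr subS indI inI delS leS).
- exact (graded_by_size ind_repr subS indI inI delS leS).
move=> C LC M; exact (splitting_injectives_cogenerate ind_repr (subS C LC)).
Qed.
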